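(* Let $G$ be a distance-regular graph of even order with valency $k$ and $\lambda\geq 1$. Then $G$ is $\left\lfloor \frac{1}{2}\left\lceil \frac{k+2}{2} \right\rceil \right\rfloor$-extendable.
   Context: All graphs are finite, simple and undirected. A connected graph $G$ of diameter $D$ is distance-regular if there are integers $b_0,\dots,b_{D-1},c_1,\dots,c_D$ such that for all vertices $x,y$ at distance $i$, the vertex $y$ has exactly $c_i$ neighbors at distance $i-1$ from $x$ (for $1\le i\le D$) and exactly $b_i$ neighbors at distance $i+1$ from $x$ (for $0\le i\le D-1$). Such a graph is regular of valency $k=b_0$. $\lambda$ is the number of common neighbors of any two adjacent vertices. A matching is a set of edges no two of which share a vertex; it is perfect if every vertex is incident with one of its edges. A connected graph of even order $v$ is called $t$-extendable if it contains a perfect matching, $t<v/2$, and every matching of $t$ edges is contained in some perfect matching. *)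

(* Defs.v *)
From mathcomp Require Import all_boot.

Set Implicit Arguments.
Unset Strict Implicit.
Unset Printing Implicit Defensive.

Section Graphs.

(* A finite simple graph is a symmetric irreflexive relation on a finType.   *)
Variables (T : finType) (e : rel T).

Definition simple_graph : Prop := symmetric e /\ irreflexive e.

(* The graph with no vertices does not count as connected. *)
Definition graph_connected : Prop :=
  0 < #|T| /\ forall x y : T, connect e x y.

Definition nbhd (x : T) : {set T} := [set y | e x y].

Definition has_walk (n : nat) (x y : T) : bool :=
  [exists p : n.-tuple T, path e x p && (last x p == y)].

(* Distinct vertices joined by a walk are joined by one of length < #|T|, so *)
(* the search below is exhaustive; the value is the dummy #|T| when x and y  *)
(* lie in different components.                                              *)
Definition gdist (x y : T) : nat :=
  find (fun n => has_walk n x y) (iota 0 #|T|).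

(* Meaningful for connected graphs only. *)
Definition diameter : nat := \max_(x : T) \max_(y : T) gdist x y.

(* Only b 0, ..., b (diameter - 1) and c 1, ..., c diameter are constrained. *)
Definition intersection_numbers (b c : nat -> nat) : Prop :=
  forall (i : nat) (x y : T), gdist x y = i ->
    (1 <= i <= diameter -> #|[set z in nbhd y | gdist x z == i.-1]| = c i) /\
    (i < diameter -> #|[set z in nbhd y | gdist x z == i.+1]| = b i).

Definition distance_regular : Prop :=
  [/\ simple_graph, graph_connected & exists b c, intersection_numbers b c].

Definition has_valency (k : nat) : Prop := forall x : T, #|nbhd x| = k.

Definition has_lambda (lam : nat) : Prop :=
  forall x y : T, e x y -> #|nbhd x :&: nbhd y| = lam.

Definition edges : {set {set T}} :=
  [set A | [exists x, exists y, e x y && (A == [set x; y])]].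

Definition matching (M : {set {set T}}) : bool :=
  (M \subset edges) && trivIset M.

Definition perfect_matching (M : {set {set T}}) : bool :=
  matching M && (cover M == [set: T]).

Definition extendable (t : nat) : Prop :=
  [/\ graph_connected /\ ~~ odd #|T|,
      exists M, perfect_matching M,
      t < #|T|./2
    & forall M, matching M -> #|M| = t ->
        exists2 N, perfect_matching N & M \subset N].

End Graphs.

(* Main.v *)
Require Import Defs.
From mathcomp Require Import all_boot zify.

Set Implicit Arguments.
Unset Strict Implicit.
Unset Printing Implicit Defensive.

(** Suppose that a matching of tau edges, where 4 tau <= k + 3, lies in no
    perfect matching.  The Tutte condition fails on the vertices left uncovered;
    adding the covered vertices to the failing set gives a set S that contains
    the matching, together with at least |S| - 2 tau + 2 disjoint odd sets
    (pieces), each of which sends all of its outgoing edges to S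
    ([extension_or_barrier]).  S with its pieces is called a barrier.

    The contradiction comes from counting the edges between S and the pieces.
    With i the degree sum inside S, the edge cuts of the pieces add up to at most
    k |S| - i ([degree_sum]).  On the other side:
    - i >= 2 tau, because S contains the matching, and i >= k times the number of
      singleton pieces, because the neighbourhood of such a piece lies in S and
      is lambda-regular with lambda >= 1, while an edge inside S has only lambda
      common neighbours ([inner_degree_singletons]).  So a singleton, whose cut
      is only k, accounts for 2k in total;
    - the other pieces have large cuts.

    Large cuts come from an isoperimetric inequality.  Let k_i be the number of
    vertices at distance i from a given one.  Spread one unit of flow along the
    geodesics joining each pair of vertices at distance i: by regularity every
    edge carries the same load, so a set A with edge cut d(A) satisfies
      k #{(x, y) in A x A^c at distance i} <= i k_i d(A)   ([cross_le]).
    Summing over i <= r bounds d(A) from below in terms of |A| and of the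
    ball sizes ([isoperimetric]).  Since k_i >= k until the last sphere, some
    radius r always gives 4 d(A) >= k (k + 2) as soon as |A| is at least
    (k + 2) / 2 and at most half of all vertices ([cut_large]); for smaller sets
    d(A) >= |A| (k + 1 - |A|) is enough.

    The final count ([no_barrier]) distinguishes tau <= 1, where edge connectivity
    k suffices; |S| >= k, where a piece that is not a singleton has a cut of at
    least 2k - 1; and |S| < k, where there is no singleton and every piece C
    satisfies |S| + |C| >= k + 2, so that small pieces force S, and with it the
    number of pieces, to be large. *)

(** * Systems of distinct representatives *)

(** Hall's theorem by the induction of Halmos and Vaughan: either some proper
    nonempty Q has exactly |Q| candidates, and the families indexed by Q and by
    its complement (with the candidates of Q removed) both satisfy the condition;
    or every such Q has a spare candidate, and any representative may be chosen
    for one index. *)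
Lemma hall (I J : finType) (j0 : J) (r : I -> {set J}) (A : {set I}) :
  (forall Q : {set I}, Q \subset A -> #|Q| <= #|\bigcup_(i in Q) r i|) ->
  exists2 f : I -> J, {in A &, injective f} & {in A, forall i, f i \in r i}.
Proof.
have [n] := ubnP #|A|; elim: n r A => // n IH r A ltAn hA.
have [->|[i iA]] := set_0Vmem A.
  by exists (fun _ => j0) => x; rewrite inE.
have [/existsP[Q /and3P[Q0 QA /eqP tQ]]|/existsPn slack] :=
  boolP [exists Q : {set I}, [&& Q != set0, Q \proper A &
                              #|Q| == #|\bigcup_(i in Q) r i|]].
  have sQA := proper_sub QA.
  have cQ : 0 < #|Q| by rewrite card_gt0.
  have cA : #|Q| + #|A :\: Q| = #|A| by rewrite -(cardsID Q A) (setIidPr sQA).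
  have ltQA := proper_card QA.
  have [||f finj fr] := IH r Q; first by lia.
    by move=> Q' sQ'; apply: hA; apply: subset_trans sQ' sQA.
  set NQ := \bigcup_(i in Q) r i in tQ.
  have [||g ginj gr] := IH (fun i => r i :\: NQ) (A :\: Q); first by lia.
    move=> Q' /subsetDP[sQ' dQ'].
    have := hA (Q' :|: Q); rewrite subUset sQ' sQA => /(_ isT).
    rewrite cardsU disjoint_setI0 // cards0 subn0 bigcup_setU -/NQ.
    have -> : (\bigcup_(i in Q') r i) :|: NQ =
              (\bigcup_(i in Q') (r i :\: NQ)) :|: NQ.
      apply/setP=> j; rewrite !inE; have [_|jNQ] := boolP (j \in NQ).
        by rewrite !orbT.
      rewrite !orbF; apply/bigcupP/bigcupP => -[l lQ' jl]; exists l => //.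
        by rewrite inE jNQ.
      by move: jl; rewrite inE => /andP[].
    rewrite cardsU; lia.
  exists (fun i => if i \in Q then f i else g i); last first.
    move=> x xA; case: ifP => [/fr//|/negbT xQ].
    by have := gr x; rewrite !inE xA xQ => /(_ isT)/andP[].
  have gNQ x : x \in A -> x \notin Q -> g x \notin NQ.
    by move=> xA xQ; have := gr x; rewrite !inE xA xQ => /(_ isT)/andP[].
  have fNQ x : x \in Q -> f x \in NQ.
    by move=> xQ; apply/bigcupP; exists x => //; apply: fr.
  move=> x y xA yA; case: ifPn => xQ; case: ifPn => yQ E.
  - exact: finj.
  - by have := gNQ _ yA yQ; rewrite -E fNQ.
  - by have := gNQ _ xA xQ; rewrite E fNQ.
  - by apply: ginj => //; rewrite inE ?xA ?yA ?xQ ?yQ.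
have /card_gt0P[j jr] : 0 < #|r i|.
  have := hA [set i]; rewrite sub1set big_set1 cards1; exact.
have cA : #|A| = (#|A :\ i|).+1 by rewrite (cardsD1 i A) iA.
have [||f finj fr] := IH (fun i => r i :\ j) (A :\ i); first by lia.
  move=> Q sQ; have [->|Q0] := eqVneq Q set0; first by rewrite cards0.
  have sQA : Q \subset A by apply: subset_trans sQ (subsetDl _ _).
  have := slack Q; rewrite Q0 /= properEneq sQA andbT.
  have -> : Q != A.
    by apply: contraTneq sQ => ->; apply/subsetPn; exists i => //; rewrite !inE eqxx.
  have := hA Q sQA => /=.
  have : \bigcup_(l in Q) r l \subset j |: \bigcup_(l in Q) (r l :\ j).
    apply/subsetP=> x /bigcupP[l lQ xl]; rewrite !inE.
    case: eqVneq => //= xj; apply/bigcupP; exists l => //.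
    by rewrite !inE xj.
  by move=> /subset_leq_card; rewrite cardsU1; lia.
have fj x : x \in A -> x != i -> f x != j.
  by move=> xA xi; have := fr x; rewrite !inE xi xA => /(_ isT)/andP[].
exists (fun x => if x == i then j else f x); last first.
  move=> x xA; case: eqVneq => [->//|xi].
  by have := fr x; rewrite !inE xi xA => /(_ isT)/andP[].
move=> x y xA yA; case: (eqVneq x i) => [->|xi]; case: (eqVneq y i) => [->|yi] // E.
- by have := fj _ yA yi; rewrite -E eqxx.
- by have := fj _ xA xi; rewrite E eqxx.
- by apply: finj => //; rewrite !inE ?xi ?yi.
Qed.

(** * Barriers and perfect matchings *)

Section Tutte.
Variables (T : finType) (e : rel T).
Hypothesis esym : symmetric e.

(** Adjacency is only tested inside U, so that these notions describe the graph
    induced on U. *)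
Definition odd_piece (U S C : {set T}) : bool :=
  [&& odd #|C|, C \subset U :\: S
    & [forall x in C, U :&: nbhd e x \subset C :|: S]].

Definition barrier (U S : {set T}) (P : {set {set T}}) : bool :=
  [&& S \subset U, trivIset P & [forall C in P, odd_piece U S C]].

Definition matched (U : {set T}) : Prop :=
  exists2 N, matching e N & cover N = U.

Lemma odd_pieceP (U S C : {set T}) :
  reflect [/\ odd #|C|, {in C, forall x, x \in U /\ x \notin S}
            & forall x y, x \in C -> y \in U -> e x y -> (y \in C) || (y \in S)]
          (odd_piece U S C).
Proof.
apply: (iffP and3P) => [[oC /subsetP sC /forall_inP hC]|[oC sC hC]].
  split=> // [x /sC|x y xC yU exy]; first by rewrite inE => /andP[].
  by have /subsetP := hC x xC; move/(_ y); rewrite !inE yU exy; apply.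
split=> //; first by apply/subsetP=> x /sC[xU xS]; rewrite inE xU xS.
apply/forall_inP=> x xC; apply/subsetP=> y; rewrite !inE => /andP[yU exy].
exact: hC exy.
Qed.

Lemma barrierP (U S : {set T}) (P : {set {set T}}) :
  reflect [/\ S \subset U, trivIset P & {in P, forall C, odd_piece U S C}]
          (barrier U S P).
Proof.
by apply: (iffP and3P) => -[? ? /forall_inP].
Qed.

Lemma odd_cover (P : {set {set T}}) :
  trivIset P -> {in P, forall C : {set T}, odd #|C|} -> odd #|cover P| = odd #|P|.
Proof.
move=> /eqP <- oP; rewrite -sum1_card !(big_morph odd oddD (erefl _)).
by apply: eq_bigr => C /oP ->.
Qed.

Lemma sub_cover (P : {set {set T}}) C : C \in P -> C \subset cover P.
Proof. by move=> CP; apply/subsetP=> x xC; apply/bigcupP; exists C. Qed.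

Definition residue (U S : {set T}) (P : {set {set T}}) := U :\: S :\: cover P.

Lemma card_residue U S P : barrier U S P ->
  #|S| + #|cover P| + #|residue U S P| = #|U|.
Proof.
move=> /barrierP[sSU tP hP].
rewrite -(cardsID S U) (setIidPr sSU) -addnA; congr addn.
rewrite -[RHS](cardsID (cover P)); congr addn.
apply: eq_card => x; rewrite !inE andbC; symmetry; apply/andb_idr.
case/bigcupP=> C /hP/odd_pieceP[_ sC _] /sC[xU xS].
by rewrite xU xS.
Qed.

(** No edge leaves a piece except to S, so by symmetry none leaves the residue
    except to S either, and an odd residue is a further piece. *)
Lemma barrier_residue U S P : barrier U S P -> odd #|residue U S P| ->
  barrier U S (residue U S P |: P) /\ #|residue U S P |: P| = #|P|.+1.
Proof.
move=> bP oR; have /barrierP[sSU tP hP] := bP.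
have R0 : residue U S P != set0 by apply: contraTneq oR => ->; rewrite cards0.
have dR : [disjoint residue U S P & cover P].
  by rewrite disjoints_subset; apply/subsetP=> x; rewrite !inE => /andP[].
have RP : residue U S P \notin P.
  apply: contra R0 => RP; rewrite -subset0 -(disjoint_setI0 dR) subsetI subxx /=.
  exact: sub_cover.
split; last by rewrite cardsU1 RP.
apply/barrierP; split=> //.
  apply/trivIsetP=> X Y; rewrite !inE.
  have aux Z : Z \in P -> [disjoint residue U S P & Z].
    by move=> ZP; apply: disjointWr dR; apply: sub_cover.
  case/predU1P=> [->|XP] /predU1P[->|YP]; rewrite ?eqxx // => XY.
  - exact: aux.
  - by rewrite disjoint_sym aux.
  - exact: (trivIsetP tP).
move=> C; rewrite !inE => /predU1P[->|/hP //].
apply/odd_pieceP; split=> // [x|x y].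
  by rewrite !inE => /and3P[].
rewrite !inE => /and3P[xcP xS xU] yU exy; rewrite yU andbT.
have [//|yS] := boolP (y \in S); first by rewrite orbT.
rewrite andbT orbF; apply: contra xcP => /bigcupP[C' C'P yC'].
have /odd_pieceP[_ _ /(_ y x yC' xU)] := hP _ C'P.
by rewrite esym exy (negPf xS) orbF => /(_ isT) xC'; apply/bigcupP; exists C'.
Qed.

(** Modulo 2 the number of pieces is the size of their union.  Hence, in a set U
    of even size, the pieces exceed S by an even number once an odd residue has
    been added as one more piece. *)
Lemma barrier_parity U S P : barrier U S P -> ~~ odd #|U| -> #|S| < #|P| ->
  exists2 P', barrier U S P' & #|S|.+2 <= #|P'|.
Proof.
move=> bP oU ltSP; have /barrierP[sSU tP hP] := bP.
have := card_residue bP.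
have : odd #|cover P| = odd #|P|.
  by apply: odd_cover => // C /hP/odd_pieceP[].
have [oR oC cU|oR oC cU] := boolP (odd #|residue U S P|).
  have [b' c'] := barrier_residue bP oR; exists (residue U S P |: P) => //.
  by rewrite c'; lia.
by exists P => //; lia.
Qed.

Lemma matchedU (U V : {set T}) : [disjoint U & V] -> matched U -> matched V ->
  matched (U :|: V).
Proof.
move=> dUV [N /andP[eN tN] cN] [N' /andP[eN' tN'] cN'].
exists (N :|: N'); last by rewrite /cover bigcup_setU -/(cover _) -/(cover _) cN cN'.
rewrite /matching subUset eN eN' /=; apply: trivIsetU => //.
by rewrite cN cN'.
Qed.

Lemma matched_pair x y : irreflexive e -> e x y -> matched [set x; y].
Proof.
move=> eirr exy; exists [set [set x; y]]; last by rewrite /cover big_set1.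
apply/andP; split.
  rewrite sub1set inE; apply/existsP; exists x; apply/existsP; exists y.
  by rewrite exy eqxx.
by apply/trivIsetP=> A B; rewrite !inE => /eqP-> /eqP->; rewrite eqxx.
Qed.

Lemma matched0 : matched set0.
Proof.
exists set0; last by rewrite /cover big_set0.
by rewrite /matching sub0set; apply/trivIsetP=> A B; rewrite inE.
Qed.

Lemma matched_bigcup (I : finType) (Q : {set I}) (W : I -> {set T}) :
  {in Q, forall i, matched (W i)} ->
  {in Q &, forall i j, i != j -> [disjoint W i & W j]} ->
  matched (\bigcup_(i in Q) W i).
Proof.
have [n] := ubnP #|Q|; elim: n Q => // n IH Q ltQn mW dW.
have [->|[i iQ]] := set_0Vmem Q; first by rewrite big_set0; apply: matched0.
rewrite (big_setD1 i) //=; apply: matchedU; last 1 first.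
- apply: IH => [|j|j l]; first by move: ltQn; rewrite (cardsD1 i Q) iQ; lia.
    by rewrite inE => /andP[_ /mW].
  by rewrite !inE => /andP[_ jQ] /andP[_ lQ]; apply: dW.
- rewrite disjoint_sym disjoints_subset; apply/bigcupsP=> j; rewrite !inE => /andP[ji jQ].
  by rewrite -disjoints_subset; apply: dW.
- exact: mW.
Qed.

Definition tutte (U : {set T}) : Prop :=
  forall S P, barrier U S P -> #|P| <= #|S|.

(** A barrier with equality and with S as large as possible.  Every way of
    enlarging it below contradicts its maximality, which makes its pieces
    fill U outside S and be matchable after the removal of any one vertex. *)
Definition maximal_tight (U S : {set T}) (P : {set {set T}}) : Prop :=
  [/\ barrier U S P, #|S| = #|P|
    & forall S' P', barrier U S' P' -> #|S'| <= #|P'| -> #|S'| <= #|S|].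

Lemma barrier_nil (U S : {set T}) : S \subset U -> barrier U S set0.
Proof.
move=> sSU; apply/barrierP; split=> // [|C]; last by rewrite inE.
by apply/trivIsetP=> A B; rewrite inE.
Qed.

Lemma cover_nil : cover (set0 : {set {set T}}) = set0.
Proof. by rewrite /cover big_set0. Qed.

Lemma tutte_even U : tutte U -> ~~ odd #|U|.
Proof.
move=> hU; apply/negP=> oU.
have := barrier_residue (barrier_nil (sub0set U)).
by rewrite /residue cover_nil !setD0 => /(_ oU)[/hU]; rewrite !cards0 => + E; rewrite E.
Qed.

(** The vertex x0 with the rest of U as its only piece is tight, so the maximum is
    taken over a nonempty family. *)
Lemma maximal_tight_exists (U : {set T}) :
  tutte U -> U != set0 -> exists S P, maximal_tight U S P.
Proof.
move=> hU /set0Pn[x0 x0U]; have evU := tutte_even hU.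
pose tight (p : {set T} * {set {set T}}) := barrier U p.1 p.2 && (#|p.1| == #|p.2|).
have t0 : tight ([set x0], residue U [set x0] set0 |: set0).
  have bx : barrier U [set x0] set0 by apply: barrier_nil; rewrite sub1set.
  have := card_residue bx; have := barrier_residue bx.
  rewrite cover_nil !cards0 cards1 => h1 h2.
  have [|b1 b2] := h1; first by clear - evU h2; lia.
  by rewrite /tight b1 b2 cards1 eqxx.
case: (arg_maxnP (fun p : {set T} * {set {set T}} => #|p.1|) t0) => -[S P].
rewrite /tight /= => /andP[bP /eqP cSP] maxS {t0}.
exists S, P; split=> // S' P' b' le'; apply: (maxS (S', P')).
by rewrite b' /= eqn_leq le'; apply: hU.
Qed.

Section MaximalTight.
Variables (U S : {set T}) (P : {set {set T}}).
Hypotheses (hU : tutte U) (mP : maximal_tight U S P).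

Let bP : barrier U S P. Proof. by case: mP. Qed.
Let cSP : #|S| = #|P|. Proof. by case: mP. Qed.
Let maxS S' P' : barrier U S' P' -> #|S'| <= #|P'| -> #|S'| <= #|S|.
Proof. by case: mP => _ _; apply. Qed.
Let sSU : S \subset U. Proof. by have /barrierP[] := bP. Qed.
Let tP : trivIset P. Proof. by have /barrierP[] := bP. Qed.
Let odP C : C \in P -> odd #|C|.
Proof. by have /barrierP[_ _ hP] := bP => /hP/odd_pieceP[]. Qed.
Let sPU C x : C \in P -> x \in C -> x \in U /\ x \notin S.
Proof. by have /barrierP[_ _ hP] := bP => /hP/odd_pieceP[_ sC _] /sC. Qed.
Let nbP C x y : C \in P -> x \in C -> y \in U -> e x y -> (y \in C) || (y \in S).
Proof. by have /barrierP[_ _ hP] := bP => /hP/odd_pieceP[_ _ hC]; apply: hC. Qed.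

(** The residue has even size; moving one of its vertices to S makes the
    rest of it a new odd piece, and the barrier stays tight. *)
Lemma maximal_tight_covers : residue U S P = set0.
Proof.
apply/eqP; apply: contraT => /set0Pn[x xR].
have evU := tutte_even hU.
have := xR; rewrite !inE => /and3P[xP xS xU].
have b' : barrier U (x |: S) P.
  apply/barrierP; split=> //.
    by rewrite subUset sub1set xU.
  move=> C CP; apply/odd_pieceP; split; first exact: odP.
    move=> y yC; have [yU yS] := sPU CP yC; split=> //.
    rewrite !inE negb_or yS andbT; apply: contraNneq xP => <-.
    by apply/bigcupP; exists C.
  by move=> y z yC zU /(nbP CP yC zU); rewrite !inE => /orP[->|->]; rewrite ?orbT.
have E : residue U (x |: S) P = residue U S P :\ x.
  by apply/setP=> y; rewrite !inE; case: (y == x); rewrite ?andbF.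
have := card_residue bP; have := card_residue b'.
have := odd_cover tP odP; rewrite E (cardsD1 x (residue _ _ _)) xR cardsU1 xS /=.
move=> o1 c1 c2; have [|b2 e2] := barrier_residue b'.
  by rewrite E; rewrite -cSP in o1; clear - o1 c1 c2 evU; lia.
by have := maxS b2; rewrite e2 cardsU1 xS /= -cSP ltnn => /(_ (leqnn _)).
Qed.

(** A violating barrier (S2, P2) of C minus x has, by parity, at least |S2| + 2
    pieces.  Replacing C by them and S by S, x and S2 gives a barrier of U
    that is again tight, but larger. *)
Lemma tutte_piece_minus C x : C \in P -> x \in C -> tutte (C :\ x).
Proof.
move=> CP xC S2 P2 b2; rewrite leqNgt; apply/negP=> lt2.
have [xU xS] := sPU CP xC.
have oC := odP CP; have cC : #|C| = #|C :\ x|.+1 by rewrite (cardsD1 x) xC.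
have [|P3 b3 lt3] := barrier_parity b2 _ lt2; first by move: oC; rewrite cC.
have /barrierP[sS3 tP3 hP3] := b3.
have sP3 D y : D \in P3 -> y \in D -> [/\ y != x, y \in C & y \notin S2].
  by move=> /hP3/odd_pieceP[_ sD _] /sD[]; rewrite !inE => /andP[].
have dP3 D : D \in P3 -> D \subset C.
  by move=> DP; apply/subsetP=> y /(sP3 _ _ DP)[].
have CC' D : D \in P -> D != C -> [disjoint C & D].
  by move=> DP DC; apply: (trivIsetP tP) => //; rewrite eq_sym.
have P3P D : D \in P3 -> D \notin P.
  move=> D3; apply/negP=> DP.
  have oD := odP DP; have [DC|DC] := eqVneq D C.
    by have := sP3 _ x D3; rewrite DC xC eqxx => /(_ isT)[].
  have := disjoint_setI0 (CC' _ DP DC).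
  by rewrite (setIidPr (dP3 _ D3)) => D0; rewrite D0 cards0 in oD.
have sS2C y : y \in S2 -> y != x /\ y \in C.
  by move=> /(subsetP sS3); rewrite !inE => /andP[].
have bb : barrier U (x |: (S :|: S2)) ((P :\ C) :|: P3).
  apply/barrierP; split.
  - rewrite !subUset sub1set xU sSU /=.
    by apply/subsetP=> y /sS2C[_ /(sPU CP)[]].
  - apply: trivIsetU => //; first exact: trivIsetS (subsetDl _ _) tP.
    rewrite disjoint_sym disjoints_subset; apply/bigcupsP=> D /dP3 sDC.
    rewrite -disjoints_subset; apply: disjointWl sDC _.
    rewrite disjoint_sym disjoints_subset; apply/bigcupsP=> D'; rewrite !inE => /andP[DC DP].
    by rewrite -disjoints_subset disjoint_sym CC'.
  move=> D; rewrite !inE => /orP[/andP[DC DP]|D3].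
    have dCD := disjointFl (CC' _ DP DC).
    apply/odd_pieceP; split; first exact: odP.
      move=> y yD; have [yU yS] := sPU DP yD; split=> //.
      rewrite !inE (negPf yS) /= negb_or; apply/andP; split.
        by apply: contraTneq xC => <-; rewrite dCD.
      by apply/negP=> /sS2C[_]; rewrite dCD.
    move=> y z yD zU /(nbP DP yD zU) /orP[->//|zS].
    by rewrite !inE zS !orbT.
  have /odd_pieceP[oD _ hD] := hP3 _ D3.
  apply/odd_pieceP; split=> // [y yD|y z yD zU eyz].
    have [yx yC yS2] := sP3 _ _ D3 yD; have [yU yS] := sPU CP yC.
    by rewrite yU !inE (negPf yx) (negPf yS).
  have [yx yC yS2] := sP3 _ _ D3 yD.
  rewrite !inE; have /orP[zC|->] := nbP CP yC zU eyz; last by rewrite !orbT.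
  have [//|zx] := eqVneq z x; first by rewrite orbT.
  by have := hD y z yD; rewrite !inE zx zC => /(_ isT eyz)/orP[]->; rewrite ?orbT.
have dS : [disjoint S & S2].
  rewrite disjoint_sym disjoints_subset; apply/subsetP=> y /sS2C[_ yC].
  by rewrite inE; have [] := sPU CP yC.
have cS : #|x |: (S :|: S2)| = (#|S| + #|S2|).+1.
  rewrite cardsU1 !inE (negPf xS) /= cardsU disjoint_setI0 // cards0 subn0.
  by case: (boolP (x \in S2)) => // /sS2C[]; rewrite eqxx.
have cP : #|(P :\ C) :|: P3| = #|P|.-1 + #|P3|.
  rewrite cardsU disjoint_setI0 ?cards0 ?subn0; first by rewrite (cardsD1 C P) CP.
  rewrite disjoint_sym disjoints_subset; apply/subsetP=> D /P3P DP.
  by rewrite !inE (negPf DP) andbF.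
have P0 : 0 < #|P| by rewrite card_gt0; apply/set0Pn; exists C.
have := maxS bb; rewrite cS cP; rewrite -cSP in P0 *.
by move: lt3 P0; clear; move: #|P3| #|S| #|S2|; lia.
Qed.

(** Hall's condition holds for the attachment of the pieces to S: a subfamily of
    the pieces is a barrier over the set of its neighbours in S. *)
Lemma barrier_transversal : U != set0 ->
  exists f : {set T} -> T,
    [/\ {in P &, injective f}, f @: P = S
      & {in P, forall C : {set T}, exists2 x, x \in C & e x (f C)}].
Proof.
pose att (C : {set T}) := [set s in S | [exists x in C, e x s]].
move=> /set0Pn[x0 _].
have [Q sQP|f finj fatt] := @hall _ _ x0 att P.
  have sAS : \bigcup_(C in Q) att C \subset S.
    by apply/bigcupsP=> C _; apply/subsetP=> y; rewrite inE => /andP[].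
  apply: hU; apply/barrierP; split.
  - exact: subset_trans sAS sSU.
  - exact: trivIsetS tP.
  move=> C CQ; have CP := subsetP sQP _ CQ.
  apply/odd_pieceP; split; first exact: odP.
    move=> x xC; have [xU xS] := sPU CP xC; split=> //.
    by apply: contra xS => /(subsetP sAS).
  move=> x y xC yU exy; have /orP[->//|yS] := nbP CP xC yU exy.
  apply/orP; right; apply/bigcupP; exists C => //.
  by rewrite inE yS; apply/existsP; exists x; rewrite xC.
exists f; split=> //.
  apply/eqP; rewrite eqEcard card_in_imset // cSP leqnn andbT.
  by apply/subsetP=> _ /imsetP[C /fatt + ->]; rewrite inE => /andP[].
by move=> C /fatt; rewrite inE => /andP[_ /existsP[x /andP[]]]; exists x.
Qed.

End MaximalTight.

(** The matching joins each piece C to its own vertex f C of S by an edge at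
    some x of C, and continues inside C minus x by induction. *)
Theorem tutte_matched U : irreflexive e -> tutte U -> matched U.
Proof.
move=> eirr; have [n] := ubnP #|U|; elim: n U => // n IH U ltUn hU.
have [->|U0] := eqVneq U set0; first exact: matched0.
have [S [P mP]] := maximal_tight_exists hU U0.
have [/barrierP[sSU tP hP] cSP _] := mP.
have sPU (C : {set T}) x : C \in P -> x \in C -> x \in U /\ x \notin S.
  by move=> /hP/odd_pieceP[_ sC _] /sC.
have crit (C : {set T}) x : C \in P -> x \in C -> matched (C :\ x).
  move=> CP xC; apply: IH; last exact: tutte_piece_minus mP _ _ CP xC.
  rewrite -ltnS; apply: leq_trans ltUn; rewrite ltnS.
  have /properD1/proper_card := xC; move/leq_trans; apply.
  by apply/subset_leq_card/subsetP=> y /(sPU _ _ CP)[].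
have [f [finj imf fatt]] := barrier_transversal hU mP U0.
have -> : U = \bigcup_(C in P) (f C |: C).
  apply/setP=> x; apply/idP/bigcupP=> [xU|[C CP]].
    have [|xS] := boolP (x \in S).
      by rewrite -imf => /imsetP[C CP ->]; exists C; rewrite // setU11.
    have /setP/(_ x) := maximal_tight_covers hU mP.
    rewrite !inE xU xS !andbT => /negbFE/bigcupP[C CP xC].
    by exists C => //; rewrite setU1r.
  rewrite !inE => /predU1P[->|xC]; last by have [] := sPU _ _ CP xC.
  by apply: (subsetP sSU); rewrite -imf imset_f.
have fS C : C \in P -> f C \in S by move=> CP; rewrite -imf imset_f.
apply: matched_bigcup => [C CP|C D CP DP CD].
  have [x xC exf] := fatt _ CP.
  have -> : f C |: C = [set x; f C] :|: (C :\ x).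
    by rewrite -{2}(setD1K xC) setUA (setUC [set x]).
  apply: matchedU; [|exact: matched_pair|exact: crit].
  rewrite disjoints_subset; apply/subsetP=> y; rewrite !inE => /pred2P[]->.
    by rewrite eqxx.
  rewrite negb_and negbK orbC; apply/orP; left; apply/negP=> fC.
  by have [_] := sPU _ _ CP fC; rewrite fS.
have dfC (A B : {set T}) : A \in P -> B \in P -> f A \notin B.
  by move=> AP BP; apply/negP=> /(sPU _ _ BP)[_]; rewrite fS.
rewrite disjoints_subset; apply/subsetP=> y; rewrite !inE negb_or.
case/predU1P=> [->|yC].
  rewrite dfC // andbT; apply: contraNneq CD => E.
  by apply/eqP; apply: finj.
rewrite (disjointFr (trivIsetP tP C D CP DP CD) yC) andbT.
by apply: contraNneq (dfC _ _ DP CP) => <-.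
Qed.

Lemma card_cover_matching M : irreflexive e -> matching e M ->
  #|cover M| = 2 * #|M|.
Proof.
move=> eirr /andP[/subsetP eM /eqP <-]; rewrite mulnC -sum_nat_const.
apply: eq_bigr => A /eM; rewrite inE => /existsP[x /existsP[y /andP[exy /eqP->]]].
by rewrite cards2; case: eqP exy => // ->; rewrite eirr.
Qed.

(** The Tutte dichotomy is applied to the vertices that M leaves uncovered; M is
    then put back into the separating set, at a cost of 2 |M|. *)
Lemma extension_or_barrier M : irreflexive e -> ~~ odd #|T| -> matching e M ->
  (exists2 N, perfect_matching e N & M \subset N) \/
  exists S P, [/\ barrier setT S P, cover M \subset S
                & #|S| + 2 <= #|P| + 2 * #|M|].
Proof.
move=> eirr evT mM; have cM := card_cover_matching eirr mM.
set U := ~: cover M.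
have cU : #|cover M| + #|U| = #|T| by rewrite cardsC.
have [/existsP[S0 /existsP[P0 /andP[b0 lt0]]]|noB] :=
  boolP [exists S, exists P, barrier U S P && (#|S| < #|P|)].
  have [|P bP leP] := barrier_parity b0 _ lt0; first by lia.
  have /barrierP[sSU tP hP] := bP.
  right; exists (S0 :|: cover M), P; split; first 1 last.
  - exact: subsetUr.
  - rewrite cardsU disjoint_setI0 ?cards0; first by lia.
    by rewrite disjoints_subset.
  apply/barrierP; split=> // C /hP/odd_pieceP[oC sC hC].
  apply/odd_pieceP; split=> // [x /sC[]|x y xC _ exy].
    by rewrite !inE negb_or => -> ->.
  rewrite inE; case: (boolP (y \in cover M)) => yM; first by rewrite !orbT.
  by rewrite orbF; apply: hC exy; rewrite // inE.
have [|N mN cN] := @tutte_matched U eirr.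
  move=> S P b; rewrite leqNgt; apply: contra noB => lt.
  by apply/existsP; exists S; apply/existsP; exists P; rewrite b.
left; exists (M :|: N); last exact: subsetUl.
have /andP[eM tM] := mM; have /andP[eN tN] := mN.
apply/andP; split.
  apply/andP; split; first by rewrite subUset eM.
  by apply: trivIsetU; rewrite // cN /U disjoint_sym disjoints_subset.
by rewrite /cover bigcup_setU -/(cover _) -/(cover _) cN setUCr.
Qed.

End Tutte.

(** * Distance in a connected graph *)

Section Distance.
Variables (T : finType) (e : rel T).
Hypothesis esym : symmetric e.
Hypothesis econn : forall x y, connect e x y.

Lemma has_walkP n x y :
  reflect (exists p, [/\ path e x p, last x p = y & size p = n])
          (has_walk e n x y).
Proof.
apply: (iffP existsP) => [[p /andP[ep /eqP lp]]|[p [ep lp sp]]].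
  by exists p; rewrite size_tuple.
have sp' : size p == n by apply/eqP.
by exists (Tuple sp'); rewrite ep lp eqxx.
Qed.

Lemma gdist_le n x y : has_walk e n x y -> gdist e x y <= n.
Proof.
move=> w; have [ltn|len] := ltnP n #|T|.
  rewrite leqNgt; apply/negP=> /(before_find 0).
  by rewrite nth_iota // w.
by apply: leq_trans (find_size _ _) _; rewrite size_iota.
Qed.

Lemma gdist_walk x y : has_walk e (gdist e x y) x y.
Proof.
have /connectP[p0 ep0 ->] := econn x y.
have [p ep up _] := shortenP ep0.
have sp : size p < #|T|.
  by have := max_card (mem (x :: p)); rewrite (card_uniqP up).
set P := fun n => has_walk e n x (last x p).
have hp : has P (iota 0 #|T|).
  apply/hasP; exists (size p); first by rewrite mem_iota.
  by apply/has_walkP; exists p.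
have := nth_find 0 hp; rewrite nth_iota //.
by rewrite has_find size_iota in hp.
Qed.

Lemma gdist0 x y : (gdist e x y == 0) = (x == y).
Proof.
apply/eqP/eqP=> [d0|->].
  by have := gdist_walk x y; rewrite d0 => /has_walkP[[|? ?] []].
by apply/eqP; rewrite -leqn0; apply: gdist_le; apply/has_walkP; exists [::].
Qed.

Lemma gdist_edge x y z : e y z -> gdist e x z <= (gdist e x y).+1.
Proof.
move=> eyz; have /has_walkP[p [ep lp sp]] := gdist_walk x y.
apply: gdist_le; apply/has_walkP; exists (rcons p z).
by rewrite rcons_path ep lp eyz last_rcons size_rcons sp.
Qed.

Lemma gdist_pred x y n : gdist e x y = n.+1 ->
  exists2 z, e z y & gdist e x z = n.
Proof.
move=> dxy; have := gdist_walk x y; rewrite dxy => /has_walkP[p []].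
case/lastP: p => // p z ep lp sp; rewrite last_rcons in lp.
move: ep sp; rewrite lp rcons_path size_rcons => /andP[ep ezy] [sp].
exists (last x p) => //; have := gdist_edge x ezy; rewrite dxy ltnS => le.
apply/eqP; rewrite eqn_leq le andbT; apply: gdist_le.
by apply/has_walkP; exists p.
Qed.

Lemma gdist_sym x y : gdist e x y = gdist e y x.
Proof.
suff le u v : gdist e v u <= gdist e u v by apply/eqP; rewrite eqn_leq !le.
have /has_walkP[p [ep lp sp]] := gdist_walk u v.
apply: gdist_le; apply/has_walkP; exists (rev (belast u p)).
rewrite -lp; split; last by rewrite size_rev size_belast sp lp.
  by rewrite rev_path (eq_path (e' := e)).
by case: p {ep lp sp} => //= a p; rewrite rev_cons last_rcons.
Qed.

Lemma gdist1 x y : irreflexive e -> (gdist e x y == 1) = e x y.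
Proof.
move=> eirr; apply/eqP/idP=> [/gdist_pred[z ezy /eqP]|exy].
  by rewrite gdist0 => /eqP->.
have := gdist_edge x exy; have := gdist0 x x; rewrite eqxx => /eqP->.
case: (gdist e x y =P 0) => [/eqP|]; last by lia.
by rewrite gdist0 => /eqP xy; rewrite xy eirr in exy.
Qed.

Lemma gdist_triangle x u v : gdist e x v <= gdist e x u + gdist e u v.
Proof.
move En : (gdist e u v) => n; elim: n v En => [|n IHn] v duv.
  by move/eqP: duv; rewrite gdist0 => /eqP->; rewrite addn0.
have [v' ev dv] := gdist_pred duv.
by apply: leq_trans (gdist_edge x ev) _; rewrite addnS ltnS; apply: IHn.
Qed.

Lemma gdist_mid x y i j : gdist e x y = i + j ->
  exists2 w, gdist e x w = i & gdist e w y = j.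
Proof.
elim: j y => [|j IH] y dxy.
  by exists y; [rewrite dxy addn0|apply/eqP; rewrite gdist0].
rewrite addnS in dxy; have [z ezy dxz] := gdist_pred dxy.
have [w dxw dwz] := IH _ dxz; exists w => //.
have := gdist_edge w ezy; have := gdist_triangle x w y.
by rewrite dwz dxw dxy; lia.
Qed.

End Distance.

(** * A numerical property of ball sizes *)

(** Here a i stands for the number of vertices at distance i, K r for the size of
    a ball of radius r, and W r for the sum of the distances inside it. *)
Section BallGrowth.
Variables (k : nat) (a : nat -> nat).
Hypotheses (k4 : 4 <= k) (a0 : a 0 = 1) (a1 : a 1 = k).
Hypothesis a_ge : forall n, a n.+2 != 0 -> k <= a n.+1.

Let K r := \sum_(i < r.+1) a i.
Let W r := \sum_(i < r.+1) i * a i.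

Let KS r : K r.+1 = K r + a r.+1.
Proof. by rewrite /K big_ord_recr. Qed.
Let WS r : W r.+1 = W r + r.+1 * a r.+1.
Proof. by rewrite /W big_ord_recr. Qed.

Let K0 : K 0 = 1. Proof. by rewrite /K big_ord1. Qed.
Let W0 : W 0 = 0. Proof. by rewrite /W big_ord1. Qed.

Lemma partial_sum_ge n : a n.+1 != 0 -> 1 + n * k <= K n.
Proof.
elim: n => [|n IH] an; first by rewrite K0.
have kle := a_ge an; have := IH; rewrite KS mulSn -lt0n => /(_ (leq_trans _ kle)).
lia.
Qed.

(** The induction step needs (k + 2) (r + 3) <= 2 K (r + 2), which follows from
    [partial_sum_ge] because 4 <= k. *)
Lemma weight_le_square r : (k + 2) * W r.+2 <= K r.+2 ^ 2.
Proof.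
elim: r => [|r IH].
  rewrite !WS !KS W0 K0 a1 -mulnn; case: (a 2) => [|y]; nia.
have [y0|yn] := eqVneq (a r.+3) 0.
  by rewrite WS KS y0 muln0 !addn0.
have := partial_sum_ge yn; move: IH; rewrite (WS r.+2) (KS r.+2) -!mulnn.
move: (W r.+2) (K r.+2) (a r.+3) => w q y; nia.
Qed.

(** For fixed r the right-hand side is concave in m and symmetric about half of
    K r.  Radius 2 serves up to half of its ball; beyond half of one ball and up
    to half of the next, the latter serves, because it does so at both ends by
    [weight_le_square] and [partial_sum_ge]. *)
Lemma weight_le_split r m : k + 2 <= 2 * m <= K r.+2 ->
  exists r', (k + 2) * W r'.+2 <= 4 * (m * (K r'.+2 - m)).
Proof.
elim: r => [|r IH] /andP[mk mK].
  exists 0; move: mK; rewrite !WS !KS W0 K0 a1.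
  move: (a 2) => y mK; nia.
have [le|lt] := leqP (2 * m) (K r.+2); first by apply: IH; rewrite mk.
exists r.+1; have := weight_le_square r; move: mK lt; rewrite (WS r.+2) (KS r.+2).
have [->|yn] := eqVneq (a r.+3) 0; first by lia.
have := partial_sum_ge yn.
move: (W r.+2) (K r.+2) (a r.+3) => w q y; nia.
Qed.

End BallGrowth.

(** * Arithmetic of the final count *)

(** In these three lemmas s is the size of the separating set, q the number of
    pieces, and tau the number of matching edges. *)
Lemma count_wide_separator k s q tau :
  5 <= k -> 4 * tau <= k + 3 -> k <= s -> s + 2 <= q + 2 * tau ->
  q * (2 * k - 1) <= k * s -> False.
Proof.
move=> k5 ht ks hq h.
have h1 : (s + 2) * (2 * k - 1) <= (q + 2 * tau) * (2 * k - 1).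
  by rewrite leq_mul2r hq orbT.
nia.
Qed.

Lemma count_large_pieces k s q tau :
  5 <= k -> 4 * tau <= k + 3 -> s + 2 <= q + 2 * tau -> 2 <= q ->
  q * (k * (k + 2)) + 4 * (2 * tau) <= 4 * (k * s) -> False.
Proof.
move=> k5 ht hq q2 h.
have h1 : k * (s + 2) <= k * (q + 2 * tau) by rewrite leq_mul2l hq orbT.
have h2 : 2 * (k * (k - 2)) <= q * (k * (k - 2)) by rewrite leq_mul2r q2 orbT.
have h3 : q * (k * (k + 2)) = q * (k * (k - 2)) + 4 * (q * k) by nia.
have h4 : (k - 1) * (4 * tau) <= (k - 1) * (k + 3) by rewrite leq_mul2l ht orbT.
nia.
Qed.

(** With m the smallest piece size, s >= k + 2 - m makes q large.  A bound
    k + 1 <= s + m would not do: k = 9, tau = 3, m = 4, s = 6, q = 2 satisfies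
    it together with the other hypotheses.  The substitution m = x + 3,
    k = 2 x + 7 + y turns the last inequality between polynomials into one
    between coefficients. *)
Lemma count_small_piece k s q tau m :
  5 <= k -> 4 * tau <= k + 3 -> s + 2 <= q + 2 * tau -> k + 2 <= s + m ->
  3 <= m -> 2 * m < k -> q * (m * (k + 1 - m)) + 2 * tau <= k * s -> False.
Proof.
move=> k5 ht hq hs m3 mk h.
have [x Em] : exists x, m = x + 3 by exists (m - 3); lia.
have [y Ek] : exists y, k = 2 * x + 7 + y by exists (k - (2 * x + 7)); lia.
have h3 : m * (k + 1 - m) = k + (x + 2) * (x + 4 + y).
  have -> : k + 1 - m = x + 5 + y by lia.
  by rewrite Em Ek; lia.
move: h; rewrite h3; set X := (x + 2) * (x + 4 + y) => h.
have h1 : k * (s + 2) <= k * (q + 2 * tau) by rewrite leq_mul2l hq orbT.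
have h4 : (k - 1) * (4 * tau) <= (k - 1) * (k + 3) by rewrite leq_mul2l ht orbT.
have h6 : (6 + y) * X <= 2 * q * X by rewrite leq_mul2r; lia.
have h7 : 4 * x + 10 + 2 * y <= (6 + y) * (x + 2) by clear; nia.
have h8 : (4 * x + 10 + 2 * y) * (2 * x + 8 + y) <= (6 + y) * (x + 2) * (2 * (x + 4 + y)).
  by apply: leq_mul; lia.
have h9 : (4 * x + 10 + 2 * y) * (2 * x + 8 + y) <= 2 * ((6 + y) * X).
  by apply: leq_trans h8 _; rewrite /X; lia.
have E1 : k - 1 = 2 * x + 6 + y by lia.
rewrite E1 in h4; move: h h1 h4 h6 h9; rewrite Ek; clear; move: X => X.
lia.
Qed.

(** * Counting in a distance-regular graph *)

Lemma double_count (T : finType) (e : rel T) (A B : {set T}) p q :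
  symmetric e ->
  {in A, forall x, #|nbhd e x :&: B| = p} ->
  {in B, forall y, #|nbhd e y :&: A| = q} ->
  p * #|A| = q * #|B|.
Proof.
move=> esym hA hB; rewrite mulnC (mulnC q) -!sum_nat_const.
transitivity (\sum_(x in A) \sum_(y in B) e x y).
  apply: eq_bigr => x /hA <-; rewrite -sum1_card big_mkcond [RHS]big_mkcond.
  by apply: eq_bigr => y _; rewrite !inE; case: (e x y); case: (y \in B).
rewrite exchange_big; apply: eq_bigr => y /hB <-.
rewrite -sum1_card big_mkcond [RHS]big_mkcond.
by apply: eq_bigr => x _; rewrite !inE esym; case: (e y x); case: (x \in A).
Qed.

Section DistanceRegular.
Variables (T : finType) (e : rel T) (k : nat) (b c : nat -> nat).
Hypotheses (esym : symmetric e) (eirr : irreflexive e).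
Hypothesis econn : forall x y, connect e x y.
Hypothesis hbc : intersection_numbers e b c.
Hypothesis hk : has_valency e k.

Local Notation d := (gdist e).

Definition sphere (x : T) (i : nat) : {set T} := [set y | d x y == i].

(** With the value 0 from the diameter on, the counting rule for b holds at
    every distance. *)
Definition bnum (i : nat) : nat := if i < diameter e then b i else 0.

Lemma gdist_diameter x y : d x y <= diameter e.
Proof.
apply: leq_trans (leq_bigmax x).
exact: (leq_bigmax (F := fun y => d x y)).
Qed.

Lemma card_c x y i : y \in sphere x i.+1 -> #|nbhd e y :&: sphere x i| = c i.+1.
Proof.
rewrite inE => /eqP dxy; have [h _] := hbc dxy.
rewrite -h; last by rewrite -dxy gdist_diameter dxy.
by apply: eq_card => z; rewrite !inE.
Qed.

Lemma card_b x y i : y \in sphere x i -> #|nbhd e y :&: sphere x i.+1| = bnum i.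
Proof.
rewrite inE => /eqP dxy; have [_ h] := hbc dxy.
rewrite /bnum; case: ltnP => [lt|le].
  by rewrite -(h lt); apply: eq_card => z; rewrite !inE.
apply: eq_card0 => z; rewrite !inE; apply/negP=> /andP[_ /eqP dz].
by have := gdist_diameter x z; rewrite dz; lia.
Qed.

Lemma sphere0 x : sphere x 0 = [set x].
Proof. by apply/setP=> y; rewrite !inE gdist0 // eq_sym. Qed.

Lemma sphere1 x : sphere x 1 = nbhd e x.
Proof. by apply/setP=> y; rewrite !inE gdist1. Qed.

Lemma c_gt0 x y i : d x y = i.+1 -> 0 < c i.+1.
Proof.
move=> dxy; have [z ezy dxz] := gdist_pred econn dxy.
have <- : #|nbhd e y :&: sphere x i| = c i.+1 by apply: card_c; rewrite inE dxy.
by rewrite card_gt0; apply/set0Pn; exists z; rewrite !inE esym ezy dxz eqxx.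
Qed.

Lemma sphere_c0 x i : c i.+1 = 0 -> sphere x i.+1 = set0.
Proof.
move=> c0; apply/setP=> y; rewrite !inE; apply/negP=> /eqP/c_gt0.
by rewrite c0.
Qed.

Lemma sphere_step x i : sphere x i = set0 -> sphere x i.+1 = set0.
Proof.
move=> s0; apply/setP=> y; rewrite !inE; apply/negP=> /eqP/(gdist_pred econn)[z _ dz].
by have /setP/(_ z) := s0; rewrite !inE dz eqxx.
Qed.

Lemma sphere_recur x i : bnum i * #|sphere x i| = c i.+1 * #|sphere x i.+1|.
Proof.
by apply: (double_count esym) => y; [apply: card_b|apply: card_c].
Qed.

Lemma card_sphere x y i : #|sphere x i| = #|sphere y i|.
Proof.
elim: i => [|i IH]; first by rewrite !sphere0 !cards1.
have [c0|cp] := posnP (c i.+1); first by rewrite !sphere_c0 ?cards0.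
by apply/eqP; rewrite -(eqn_pmul2l cp) -!sphere_recur IH.
Qed.

Lemma card_sphere1 x : #|sphere x 1| = k.
Proof. by rewrite sphere1 hk. Qed.

(** The vertices whose geodesics to y can be taken to arrive through z, when z is
    a neighbour of y. *)
Definition shadow z y i : {set T} := sphere z i :&: sphere y i.+1.

(** A neighbour w of a vertex of the shadow that is farther from y is also farther
    from z, since the distances to y and z differ by at most one; dually for
    neighbours closer to z. *)
Lemma shadow_recur z y i : e z y ->
  bnum i.+1 * #|shadow z y i| = c i.+1 * #|shadow z y i.+1|.
Proof.
move=> ezy; apply: (double_count esym) => x; rewrite inE => /andP[xz xy].
  rewrite -(card_b xy); apply: eq_card => w; rewrite !inE.
  case: (boolP (e x w)) => //= exw; case: (d y w =P i.+2) => [dyw|]; rewrite ?andbF // andbT.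
  have := gdist_edge econn z exw; have := gdist_edge econn w ezy.
  rewrite (gdist_sym esym econn w z) (gdist_sym esym econn w y) dyw.
  by move: xz; rewrite inE => /eqP-> h1 h2; rewrite eqn_leq h2.
rewrite -(card_c xz); apply: eq_card => w; rewrite !inE.
case: (boolP (e x w)) => //= exw; case: (d z w =P i) => //= dzw.
have := gdist_edge econn w ezy; have := gdist_edge econn y (y := w) (z := x).
rewrite esym exw => /(_ isT); move: xy; rewrite inE => /eqP->.
rewrite (gdist_sym esym econn w z) (gdist_sym esym econn w y) dzw => h1 h2.
by rewrite eqn_leq h2.
Qed.

(** The sizes of the shadows and of the spheres obey the same recursion, which
    makes the number of shadowed vertices independent of the edge: every edge
    carries the same number of geodesics. *)
Lemma card_shadow x z y i : e z y ->
  k * #|shadow z y i| = c i.+1 * #|sphere x i.+1|.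
Proof.
move=> ezy; elim: i => [|i IH].
  rewrite -sphere_recur sphere0 cards1 muln1.
  have <- : #|nbhd e x :&: sphere x 1| = bnum 0.
    by apply: card_b; rewrite sphere0 inE.
  rewrite sphere1 setIid hk /shadow sphere0 sphere1.
  by rewrite (setIidPl _) ?cards1 ?muln1 // sub1set inE esym.
have [c0|cp] := posnP (c i.+1).
  have s0 w : sphere w i.+2 = set0 by rewrite sphere_step ?sphere_c0.
  by rewrite /shadow !s0 setI0 cards0 !muln0.
apply/eqP; rewrite -(eqn_pmul2l cp) mulnCA -shadow_recur // -sphere_recur.
by rewrite mulnCA IH mulnCA.
Qed.

Definition cut (A : {set T}) : nat := \sum_(x in A) #|nbhd e x :\: A|.

Definition cross (A : {set T}) (i : nat) : nat :=
  \sum_(x in A) #|sphere x i :\: A|.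

Lemma card_setD_sum (X A : {set T}) : #|X :\: A| = \sum_(y | y \notin A) (y \in X).
Proof.
rewrite -sum1_card big_mkcond [RHS]big_mkcond; apply: eq_bigr => y _.
by rewrite !inE; case: (y \in A); case: (y \in X).
Qed.

Lemma card_setI_sum (X A : {set T}) : #|X :&: A| = \sum_(y in A) (y \in X).
Proof.
rewrite -sum1_card big_mkcond [RHS]big_mkcond; apply: eq_bigr => y _.
by rewrite !inE; case: (y \in A); case: (y \in X).
Qed.

(** For x in A and y outside A at distance i + 1, let z be a neighbour of y at
    distance i from x.  If z is outside A, then (x, z) is a crossing pair
    at distance i; if z is in A, then (z, y) is an edge of the cut and x lies in
    its shadow. *)
Lemma cross_recur A i x0 :
  k * (c i.+1 * cross A i.+1) <=
  k * (bnum i * cross A i) + cut A * (c i.+1 * #|sphere x0 i.+1|).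
Proof.
(* indicates that z precedes y on a geodesic of length i + 1 from x *)
pose t x y z : nat := [&& d x y == i.+1, e y z & d x z == i].
have -> : c i.+1 * cross A i.+1 =
    \sum_(x in A) \sum_(y | y \notin A) \sum_(z | z \notin A) t x y z +
    \sum_(x in A) \sum_(y | y \notin A) \sum_(z in A) t x y z.
  rewrite -big_split /cross big_distrr /=; apply: eq_bigr => x xA.
  rewrite -big_split card_setD_sum big_distrr /=; apply: eq_bigr => y yA.
  rewrite addnC -(bigID (fun z => z \in A) xpredT) /= inE /t.
  case: eqP => [dxy|_]; last by rewrite muln0 big1.
  rewrite muln1 -(card_c (x := x) (y := y)) ?inE ?dxy // -sum1_card big_mkcond.
  by apply: eq_bigr => z _; rewrite !inE; case: (_ && _).
rewrite mulnDr leq_add //.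
  rewrite leq_mul2l; apply/orP; right.
  rewrite /cross big_distrr /=; apply: leq_sum => x xA.
  rewrite exchange_big card_setD_sum big_distrr /=; apply: leq_sum => z zA.
  rewrite inE /t; case: (d x z =P i) => [dxz|_]; last first.
    by rewrite big1 // => y _; rewrite !andbF.
  rewrite muln1 -(card_b (x := x) (y := z)) ?inE ?dxz //.
  rewrite (eq_bigr (fun y => nat_of_bool (y \in nbhd e z :&: sphere x i.+1))).
    by rewrite -card_setD_sum subset_leq_card // subsetDl.
  by move=> y _; rewrite !inE andbT andbC esym.
rewrite /cut big_distrl /=.
have -> : \sum_(x in A) \sum_(y | y \notin A) \sum_(z in A) t x y z =
          \sum_(z in A) \sum_(y | y \notin A) \sum_(x in A) t x y z.
  rewrite exchange_big [RHS]exchange_big; apply: eq_bigr => y _.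
  exact: exchange_big.
rewrite big_distrr /=; apply: leq_sum => z zA.
rewrite card_setD_sum big_distrl big_distrr /=; apply: leq_sum => y yA.
rewrite inE /t; have [ezy|nezy] := boolP (e z y); last first.
  by rewrite big1 ?muln0 // => x _; rewrite esym (negPf nezy) andbF.
rewrite mul1n -(card_shadow _ _ ezy) leq_mul2l; apply/orP; right.
rewrite (eq_bigr (fun x => nat_of_bool (x \in shadow z y i))).
  by rewrite -card_setI_sum subset_leq_card // subsetIl.
move=> x _; rewrite !inE esym ezy /= andbC.
by rewrite (gdist_sym esym econn x z) (gdist_sym esym econn x y).
Qed.

Lemma cross_le A i x0 : k * cross A i <= i * #|sphere x0 i| * cut A.
Proof.
elim: i => [|i IH].
  rewrite /cross big1 ?muln0 // => x xA.
  by apply/eqP; rewrite cards_eq0 setD_eq0 sphere0 sub1set.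
have [c0|cp] := posnP (c i.+1).
  rewrite /cross big1 ?muln0 // => x xA.
  by rewrite sphere_c0 // set0D cards0.
rewrite -(leq_pmul2l cp) mulnCA.
apply: leq_trans (cross_recur A i x0) _.
rewrite mulnCA; apply: leq_trans (leq_add (leq_mul (leqnn (bnum i)) IH) (leqnn _)) _.
have E := sphere_recur x0 i.
have -> : bnum i * (i * #|sphere x0 i| * cut A) = i * (c i.+1 * #|sphere x0 i.+1|) * cut A.
  by rewrite -E; nia.
by move: (c i.+1) #|_| (cut A) => p q r; nia.
Qed.

Definition ball (x : T) (r : nat) := \sum_(i < r.+1) #|sphere x i|.
Definition weight (x : T) (r : nat) := \sum_(i < r.+1) i * #|sphere x i|.

Lemma sum_sphere_mem x r (y : T) : \sum_(i < r.+1) (y \in sphere x i) = (d x y <= r).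
Proof.
rewrite -ltnS; case: ltnP => [lt|le].
  rewrite (bigD1 (Ordinal lt)) //= inE eqxx big1 // => i ne.
  by rewrite inE; case: eqP => // E; case/eqP: ne; apply/val_inj.
by rewrite big1 // => i _; rewrite inE; case: eqP => // E; have := ltn_ord i; lia.
Qed.

(** Each x of A has at least ball - |A| vertices outside A within distance r. *)
Lemma isoperimetric (A : {set T}) r x0 :
  k * (#|A| * (ball x0 r - #|A|)) <= weight x0 r * cut A.
Proof.
apply: (@leq_trans (\sum_(i < r.+1) k * cross A i)); last first.
  by rewrite /weight big_distrl; apply: leq_sum => i _; apply: cross_le.
rewrite -big_distrr leq_mul2l; apply/orP; right.
rewrite /cross exchange_big -sum_nat_const /=; apply: leq_sum => x xA.
rewrite leq_subLR.
have -> : ball x0 r = \sum_(i < r.+1) (#|sphere x i :&: A| + #|sphere x i :\: A|).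
  by apply: eq_bigr => i _; rewrite cardsID (card_sphere x0 x).
rewrite big_split leq_add2r /=.
under eq_bigr do rewrite card_setI_sum.
rewrite exchange_big -sum1_card /=; apply: leq_sum => y _.
by rewrite sum_sphere_mem leq_b1.
Qed.

Lemma ball_full x : ball x #|T| = #|T|.
Proof.
rewrite /ball -[RHS]cardsT -sum1_card.
transitivity (\sum_(i < #|T|.+1) \sum_(y in [set: T]) (y \in sphere x i)).
  by apply: eq_bigr => i _; rewrite -card_setI_sum setIT.
rewrite exchange_big; apply: eq_bigr => y _.
rewrite sum_sphere_mem.
by rewrite /gdist (leq_trans (find_size _ _)) // size_iota.
Qed.

(** On a geodesic from x to y, the neighbours of an intermediate vertex that are
    closer to y are farther from x. *)
Lemma c_le_bnum x y j l : d x y = j + l.+1 -> c l.+1 <= bnum j.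
Proof.
move=> dxy; have [w dxw dwy] := gdist_mid econn dxy.
rewrite -(card_b (x := x) (y := w)) ?inE ?dxw //.
rewrite -(card_c (x := y) (y := w)) ?inE; last by rewrite gdist_sym // dwy.
apply: subset_leq_card; apply/subsetP=> z; rewrite !inE => /andP[ewz /eqP dyz].
rewrite ewz /=; have := gdist_edge econn x ewz; have := gdist_triangle econn x z y.
by rewrite (gdist_sym esym econn z y) dyz dxy dxw => h1 h2; rewrite eqn_leq h2; lia.
Qed.

Lemma sphere_prod x n :
  #|sphere x n.+1| * \prod_(j < n) c j.+2 = k * \prod_(j < n) bnum j.+1.
Proof.
elim: n => [|n IH]; first by rewrite !big_ord0 card_sphere1.
rewrite !big_ord_recr /= [RHS]mulnA -IH mulnCA [X in _ * X]mulnC -sphere_recur.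
by rewrite mulnCA mulnC [_ * #|_|]mulnC.
Qed.

(** In the product formula for sphere sizes, each c is matched with a b that
    dominates it: c (j + 2) with b (n - j), as the indices add up to n + 2. *)
Lemma card_sphere_ge x y n : d x y = n.+2 -> k <= #|sphere x n.+1|.
Proof.
move=> dxy; have le : \prod_(j < n) c j.+2 <= \prod_(j < n) bnum j.+1.
  rewrite [X in _ <= X](reindex_inj rev_ord_inj) /=.
  apply: leq_prod => j _; apply: (@c_le_bnum x y); rewrite dxy.
  by have := ltn_ord j; lia.
have pos : 0 < \prod_(j < n) c j.+2.
  rewrite prodn_gt0 // => j.
  have [|w dw _] := @gdist_mid _ _ econn x y j.+2 (n - j).
    by rewrite dxy; have := ltn_ord j; lia.
  exact: c_gt0 dw.
by rewrite -(leq_pmul2r pos) sphere_prod leq_mul2l le orbT.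
Qed.

(** The inequality [isoperimetric] at the radius supplied by [weight_le_split]. *)
Lemma cut_large (A : {set T}) : 4 <= k ->
  k + 2 <= 2 * #|A| -> 2 * #|A| <= #|T| -> k * (k + 2) <= 4 * cut A.
Proof.
move=> k4 leA Ale.
have [x0 x0A] : exists x0, x0 \in A by apply/set0Pn; rewrite -card_gt0; lia.
have T2 : #|T| = (#|T| - 2).+2 by lia.
have [||||r] := @weight_le_split k (fun i => #|sphere x0 i|) k4 _ _ _ (#|T| - 2) #|A|.
- by rewrite sphere0 cards1.
- exact: card_sphere1.
- move=> n; rewrite cards_eq0 => /set0Pn[y]; rewrite inE => /eqP.
  exact: card_sphere_ge.
- by rewrite leA /= -[X in _ <= X]/(ball x0 (#|T| - 2).+2) -T2 ball_full.
have := isoperimetric A r.+2 x0; rewrite /ball /weight.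
have : 0 < \sum_(i < r.+3) i * #|sphere x0 i|.
  rewrite (bigD1 (Ordinal (isT : 1 < r.+3))) //= (card_sphere1 x0); lia.
move: (\sum_(i < _) i * _) (_ * (_ - _)) (cut A) => w p q w0 h1 h2.
rewrite -(leq_pmul2l w0).
have : k * ((k + 2) * w) <= k * (4 * p) by rewrite leq_mul2l h2 orbT.
nia.
Qed.

Lemma cut_local (A : {set T}) : #|A| * (k + 1 - #|A|) <= cut A.
Proof.
rewrite -sum_nat_const; apply: leq_sum => x xA.
have xN : x \notin nbhd e x by rewrite inE eirr.
have := cardsID A (nbhd e x); rewrite hk.
have : nbhd e x :&: A \subset A :\ x.
  rewrite subsetD1 subsetIr /=; apply: contra xN; by rewrite inE => /andP[].
move/subset_leq_card; have := cardsD1 x A; rewrite xA; lia.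
Qed.

Lemma cutC (A : {set T}) : cut (~: A) = cut A.
Proof.
rewrite /cut; under eq_bigr do rewrite card_setD_sum.
under [RHS]eq_bigr do rewrite card_setD_sum.
rewrite [RHS]exchange_big /=; apply: eq_big => x; first by rewrite inE.
move=> _; apply: eq_big => y; first by rewrite inE negbK.
by rewrite !inE esym.
Qed.

Lemma edge_connectivity (A : {set T}) : 4 <= k ->
  A != set0 -> A != [set: T] -> k <= cut A.
Proof.
move=> k4; wlog small : A / 2 * #|A| <= #|T|.
  move=> IH A0 AT; have := cardsC A => cA.
  case: (leqP (2 * #|A|) #|T|) => [|big]; first by move/IH; apply.
  rewrite -cutC; apply: IH; first by lia.
    by apply: contraNneq AT => A0'; rewrite -(setCK A) A0' setC0.
  by apply: contraNneq A0 => AT'; rewrite -(setCK A) AT' setCT.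
move=> A0 _; have pos : 0 < #|A| by rewrite card_gt0.
have := cut_local A; have := @cut_large A k4.
case: (leqP #|A| k) => h h1 h2; first by nia.
have := h1 _ small; nia.
Qed.

Variable lam : nat.
Hypothesis hlam : has_lambda e lam.

(** A geodesic from x to y ends with w, z, y where w and y are not adjacent; the
    neighbours of z other than w and y contain all common neighbours of z
    and y. *)
Lemma lambda_lt x y : x != y -> ~~ e x y -> lam + 2 <= k.
Proof.
move=> xy nexy; have [n dn] : exists n, d x y = n + 2.
  exists (d x y - 2); rewrite subnK // ltn_neqAle eq_sym gdist1 //.
  by rewrite nexy lt0n gdist0.
have [w _ dwy] := gdist_mid econn dn.
have [z ezy dwz] := gdist_pred econn dwy.
have ezw : e z w by rewrite esym -(gdist1 econn) // dwz.
have nwy : w != y by rewrite -(gdist0 econn) dwy.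
have ewy : ~~ e w y by rewrite -(gdist1 econn) // dwy.
rewrite -(hlam ezy) -(hk z).
have : nbhd e z :&: nbhd e y \subset nbhd e z :\: [set w; y].
  apply/subsetP=> v; rewrite !inE => /andP[-> eyv]; rewrite andbT negb_or.
  by apply/andP; split; apply: contraTneq eyv => ->; rewrite ?eirr // esym.
have sub : [set w; y] \subset nbhd e z.
  by apply/subsetP=> v; rewrite !inE => /pred2P[]->.
move/subset_leq_card; rewrite cardsD (setIidPr sub).
by have := subset_leq_card sub; rewrite cards2 nwy; lia.
Qed.

(** The neighbourhood of x would be a 1-regular graph on three vertices. *)
Lemma valency3_lambda (x : T) : k = 3 -> lam != 1.
Proof.
move=> k3; apply/eqP=> l1.
have one y : e x y -> exists z, nbhd e x :&: nbhd e y = [set z].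
  by move=> /hlam; rewrite l1 => /eqP/cards1P.
have [y exy] : exists y, e x y.
  have : 0 < #|nbhd e x| by rewrite hk k3.
  by rewrite card_gt0 => /set0Pn[y]; rewrite inE; exists y.
have [z Nz] := one y exy.
have : z \in nbhd e x :&: nbhd e y by rewrite Nz inE.
rewrite !inE => /andP[exz eyz].
have yz : y != z by apply: contraTneq eyz => ->; rewrite eirr.
have [z' Nz'] := one z exz.
have {Nz'} Ny : nbhd e x :&: nbhd e z = [set y].
  have : y \in nbhd e x :&: nbhd e z by rewrite !inE exy esym.
  by rewrite Nz' inE => /eqP->.
have [w ww] : exists w, w \in nbhd e x :\: [set y; z].
  apply/set0Pn; rewrite -card_gt0 cardsD hk k3.
  have := subset_leq_card (subsetIr (nbhd e x) [set y; z]).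
  by rewrite cards2 yz; lia.
move: ww; rewrite !inE negb_or => /andP[/andP[wy wz] exw].
have [p Np] := one w exw.
have : p \in nbhd e x :&: nbhd e w by rewrite Np inE.
rewrite !inE => /andP[exp ewp].
have pw : p != w by apply: contraTneq ewp => ->; rewrite eirr.
have py : p != y.
  apply: contraNneq wz => py; have : w \in nbhd e x :&: nbhd e y.
    by rewrite !inE exw esym -py.
  by rewrite Nz inE.
have pz : p != z.
  apply: contraNneq wy => pz; have : w \in nbhd e x :&: nbhd e z.
    by rewrite !inE exw esym -pz.
  by rewrite Ny inE.
have : [set y; z; w; p] \subset nbhd e x.
  by apply/subsetP=> v; rewrite !inE => /orP[/orP[/pred2P[]|/eqP]|/eqP] ->.
move/subset_leq_card; rewrite hk k3 -!setUA !cardsU1 cards1 !inE.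
rewrite (negPf yz) !(eq_sym y) !(eq_sym z) (negPf wy) (negPf py) (negPf wz) (negPf pz).
by rewrite eq_sym (negPf pw).
Qed.

(** * Edge counts around a barrier *)

Section Barrier.
Variables (S : {set T}) (P : {set {set T}}).
Hypothesis bP : barrier e [set: T] S P.

Definition inner_degree : nat := \sum_(x in S) #|nbhd e x :&: S|.

Lemma piece_odd C : C \in P -> odd #|C|.
Proof. by have /barrierP[_ _ hP] := bP => /hP/odd_pieceP[]. Qed.

Lemma piece_disjoint C x : C \in P -> x \in C -> x \notin S.
Proof. by have /barrierP[_ _ hP] := bP => /hP/odd_pieceP[_ sC _] /sC[]. Qed.

Lemma piece_nbhd C x : C \in P -> x \in C -> nbhd e x \subset C :|: S.
Proof.
have /barrierP[_ _ hP] := bP => /hP/odd_pieceP[_ _ hC] xC.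
by apply/subsetP=> y; rewrite !inE; apply: hC.
Qed.

Lemma degree_sum : \sum_(C in P) cut C + inner_degree <= k * #|S|.
Proof.
have -> : k * #|S| = \sum_(x in S) #|nbhd e x :\: S| + inner_degree.
  rewrite mulnC -sum_nat_const -big_split; apply: eq_bigr => x _.
  by rewrite /= addnC cardsID hk.
rewrite leq_add2r -[X in _ <= X]/(cut S) -cutC.
have /barrierP[_ tP _] := bP.
have -> : \sum_(C in P) cut C = \sum_(x in cover P) #|nbhd e x :&: S|.
  rewrite big_trivIset //; apply: eq_bigr => C CP; apply: eq_bigr => x xC.
  apply: eq_card => y; rewrite !inE.
  case: (boolP (e x y)) => exy; rewrite ?andbF //= andbT.
  have /subsetP/(_ y) := piece_nbhd CP xC; rewrite !inE => /(_ exy).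
  by case: (boolP (y \in C)) => [yC _|//]; rewrite (negPf (piece_disjoint CP yC)).
rewrite /cut; apply: (@leq_trans (\sum_(x in cover P) #|nbhd e x :\: ~: S|)).
  by apply: leq_sum => x _; rewrite setDE setCK.
rewrite [X in _ <= X](bigID (fun x => x \in cover P)) /=.
apply: leq_trans (leq_addr _ _); rewrite leq_eqVlt; apply/orP; left; apply/eqP.
apply: eq_bigl => x; rewrite inE andbC; symmetry; apply/andb_idr => /bigcupP[C CP].
exact: piece_disjoint.
Qed.

Lemma inner_degree_matching M : matching e M -> cover M \subset S ->
  2 * #|M| <= inner_degree.
Proof.
move=> mM sMS; rewrite -(card_cover_matching eirr mM).
apply: (@leq_trans (\sum_(x in cover M) #|nbhd e x :&: S|)); last first.
  rewrite /inner_degree [X in _ <= X](bigID (fun x => x \in cover M)) /=.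
  apply: leq_trans (leq_addr _ _); rewrite leq_eqVlt; apply/orP; left; apply/eqP.
  apply: eq_bigl => x; rewrite andbC; symmetry; apply/andb_idr.
  exact: subsetP.
rewrite -sum1_card; apply: leq_sum => x xM; rewrite card_gt0; apply/set0Pn.
have /bigcupP[A AM xA] := xM; have /andP[/subsetP/(_ A AM)] := mM.
rewrite inE => /existsP[u /existsP[v /andP[euv /eqP EA]]] _.
have inS w : w \in A -> w \in S.
  by move=> wA; apply: (subsetP sMS); apply/bigcupP; exists A.
have [uA vA] : u \in A /\ v \in A by rewrite EA !inE !eqxx orbT.
move: xA; rewrite EA !inE => /pred2P[]->.
  by exists v; rewrite !inE euv inS.
by exists u; rewrite !inE esym euv inS.
Qed.

(** Count triangles with a base y z inside S and an apex x that is a singleton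
    piece: each apex sees k lambda ordered bases, and each base has at most
    lambda apices. *)
Lemma inner_degree_singletons : 0 < lam ->
  k * #|[set C in P | #|C| == 1]| <= inner_degree.
Proof.
move=> lam0; rewrite -(leq_pmul2l lam0).
set I := [set x | [set x] \in P].
have -> : #|[set C in P | #|C| == 1]| = #|I|.
  rewrite -(card_imset I set1_inj); apply: eq_card => C; rewrite !inE.
  apply/andP/imsetP=> [[CP /cards1P[x xC]]|[x]].
    by exists x; rewrite // inE -xC.
  by rewrite inE => xP ->; rewrite xP cards1.
have IS x : x \in I -> nbhd e x \subset S.
  rewrite inE => xP; have := piece_nbhd xP (set11 x); move/subsetP=> h.
  apply/subsetP=> y xy; have := h y xy; rewrite !inE.
  by case: eqP => //= yx; move: xy; rewrite yx inE eirr.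
pose t x y z : nat := [&& e x y, e x z & e y z].
have -> : lam * (k * #|I|) = \sum_(x in I) \sum_(y in S) \sum_(z in S) t x y z.
  rewrite mulnA mulnC -sum_nat_const; apply: eq_bigr => x xI.
  have sx := subsetP (IS x xI).
  transitivity (\sum_(y in nbhd e x) lam); first by rewrite sum_nat_const hk mulnC.
  rewrite big_mkcond [RHS]big_mkcond; apply: eq_bigr => y _; rewrite inE.
  case: (boolP (e x y)) => exy; last first.
    by case: ifP => // _; rewrite big1 // => z _; rewrite /t (negPf exy).
  rewrite sx ?inE // -(hlam exy) -sum1_card big_mkcond [RHS]big_mkcond.
  apply: eq_bigr => z _; rewrite /t exy !inE; have := sx z; rewrite inE.
  by case: (e x z) => [->//|_]; case: (z \in S).
rewrite exchange_big big_distrr /=; apply: leq_sum => y yS.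
rewrite exchange_big /=.
have -> : lam * #|nbhd e y :&: S| = \sum_(z in S) (z \in nbhd e y) * lam.
  by rewrite -big_distrl -card_setI_sum mulnC.
apply: leq_sum => z zS; rewrite inE; case: (boolP (e y z)) => eyz; last first.
  by rewrite big1 // => x _; rewrite /t (negPf eyz) !andbF.
rewrite mul1n -(hlam eyz).
apply: (@leq_trans (\sum_(x in I) (x \in nbhd e y :&: nbhd e z))).
  by apply: leq_sum => x _; rewrite /t !inE eyz andbT !(esym _ x).
by rewrite -card_setI_sum subset_leq_card // subsetIl.
Qed.

(** As S cannot contain a whole neighbourhood, C contains an edge x y, and the
    2k - lambda vertices adjacent to x or y all lie in C or S. *)
Lemma narrow_separator_card C : lam + 2 <= k -> C \in P -> #|S| < k ->
  3 <= #|C| /\ k + 2 <= #|S| + #|C|.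
Proof.
move=> lam_lt CP Sk; have oC := piece_odd CP.
have [x xC] : exists x, x \in C by apply/set0Pn; rewrite -card_gt0; lia.
have /subsetPn[y xy yS] : ~~ (nbhd e x \subset S).
  by apply: contraL Sk => /subset_leq_card; rewrite hk -leqNgt.
have yC : y \in C.
  by have /subsetP/(_ y xy) := piece_nbhd CP xC; rewrite inE (negPf yS) orbF.
have exy : e x y by rewrite inE in xy.
split.
  have : [set x; y] \subset C by apply/subsetP=> z; rewrite !inE => /pred2P[]->.
  move/subset_leq_card; rewrite cards2; case: eqP exy => [->|_ _ h].
    by rewrite eirr.
  by move: h oC; move: #|C| => [|[|[|n]]].
have : nbhd e x :|: nbhd e y \subset C :|: S by rewrite subUset !piece_nbhd.
move/subset_leq_card; rewrite cardsU !hk (hlam exy) => h.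
have := leq_trans h (leq_card_setU C S).1; move: lam_lt; lia.
Qed.

Lemma card_piece_separator C : C \in P -> #|C| + #|S| <= #|T|.
Proof.
move=> CP; rewrite -(cardsC S) addnC leq_add2l.
by apply/subset_leq_card/subsetP=> x xC; rewrite inE (piece_disjoint CP xC).
Qed.

Lemma card_two_pieces C C' : C \in P -> C' \in P -> C != C' ->
  #|C| + (#|S| + #|C'|) <= #|T|.
Proof.
move=> CP CP' CC'; have /barrierP[_ tP _] := bP.
have dC := disjoint_setI0 (trivIsetP tP _ _ CP CP' CC').
have dS D : D \in P -> D :&: S = set0.
  move=> DP; apply: disjoint_setI0; rewrite disjoints_subset.
  by apply/subsetP=> x xD; rewrite inE (piece_disjoint DP xD).
have := max_card (mem (C :|: (S :|: C'))).
rewrite cardsU setIUr dS // dC setU0 cards0 subn0 cardsU (setIC S) dS //.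
by rewrite cards0 subn0.
Qed.

(** Whichever of C and its complement has at most half of the vertices is large
    enough for [cut_large]; n bounds the complement from below. *)
Lemma large_piece_cut (C : {set T}) n : 4 <= k -> #|C| + n <= #|T| -> k + 2 <= 2 * n ->
  k + 2 <= 2 * #|C| -> k * (k + 2) <= 4 * cut C.
Proof.
move=> k4 hn kn kC; have [|big] := leqP (2 * #|C|) #|T|; first exact: cut_large.
have := cardsC C => cC.
by rewrite -cutC; apply: cut_large => //; lia.
Qed.

Lemma wide_separator_cut C : C \in P -> k <= #|S| -> 5 <= k -> #|C| != 1 ->
  2 * k - 1 <= cut C.
Proof.
move=> CP kS k5 C1; have k4 := ltnW k5; have oC := piece_odd CP.
have C3 : 3 <= #|C| by move: oC C1; move: #|C| => [|[|[|n]]].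
have [le|gt] := leqP #|C| (k - 2).
  by have := cut_local C; nia.
have : k * (k + 2) <= 4 * cut C.
  by apply: (@large_piece_cut C #|S| k4); [exact: card_piece_separator|lia|lia].
nia.
Qed.

(** The complement of C contains S and C', hence is large. *)
Lemma piece_cut_half C C' : 4 <= k -> C \in P -> C' \in P -> C != C' ->
  k + 2 <= #|S| + #|C'| -> k <= 2 * #|C| -> k * (k + 2) <= 4 * cut C.
Proof.
move=> k4 CP CP' CC' kC' kC.
have [le|gt] := leqP (2 * #|C|) (k + 1).
  by have := cut_local C; nia.
by apply: (large_piece_cut k4 (card_two_pieces CP CP' CC')); lia.
Qed.

(** The three cases are closed by the arithmetic of edge connectivity, by
    [count_wide_separator], and, when |S| < k, by [count_large_pieces] or
    [count_small_piece] according to the size of the smallest piece. *)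
Lemma no_barrier tau : 4 <= k -> lam + 2 <= k -> 0 < lam ->
  4 * tau <= k + 3 -> 2 * tau <= #|S| -> 2 * tau <= inner_degree ->
  #|S| + 2 <= #|P| + 2 * tau -> False.
Proof.
move=> k4 llt lam0 ht hS hI hP.
have hdeg := degree_sum; have hsing := inner_degree_singletons lam0.
have P2 : 1 < #|P| by lia.
have other C : C \in P -> exists2 C', C' \in P & C != C'.
  move=> CP; have : 0 < #|P :\ C| by have := cardsD1 C P; rewrite CP; lia.
  by rewrite card_gt0 => /set0Pn[C']; rewrite !inE eq_sym => /andP[]; exists C'.
have [t1|t2] := leqP tau 1.
  have : k * #|P| <= \sum_(C in P) cut C.
    rewrite mulnC -sum_nat_const; apply: leq_sum => C CP.
    have [C' CP' CC'] := other C CP.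
    apply: edge_connectivity => //.
      by apply: contraTneq (piece_odd CP) => ->; rewrite cards0.
    apply: contraTneq (card_two_pieces CP CP' CC') => ->.
    rewrite cardsT -ltnNge -[X in X < _]addn0 ltn_add2l addn_gt0.
    by rewrite (odd_gt0 (piece_odd CP')) orbT.
  have : k * (#|S| + 2) <= k * (#|P| + 2 * tau) by rewrite leq_mul2l hP orbT.
  nia.
have k5 : 5 <= k by lia.
have [kS|Sk] := leqP k #|S|.
  apply: (@count_wide_separator k #|S| #|P| tau) => //.
  apply: leq_trans hdeg; apply: leq_trans (leq_add (leqnn _) hsing).
  rewrite -sum1_card [X in X * _](bigID (fun C : {set T} => #|C| == 1)) /=.
  rewrite [X in _ <= X + _](bigID (fun C : {set T} => #|C| == 1)) /=.
  have -> : #|[set C in P | #|C| == 1]| = \sum_(C in P | #|C| == 1) 1.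
    by rewrite -sum1_card; apply: eq_bigl => C; rewrite inE.
  have le1 : \sum_(C in P | #|C| == 1) k <= \sum_(C in P | #|C| == 1) cut C.
    apply: leq_sum => C /andP[CP /eqP C1].
    by have := cut_local C; rewrite C1 addn1 subn1 mul1n.
  have le2 : \sum_(C in P | #|C| != 1) (2 * k - 1) <= \sum_(C in P | #|C| != 1) cut C.
    by apply: leq_sum => C /andP[CP C1]; apply: wide_separator_cut.
  rewrite -[X in \sum_(C in P | #|C| == 1) X]muln1 -big_distrr /= in le1.
  rewrite -[X in \sum_(C in P | #|C| != 1) X]muln1 -big_distrr /= in le2.
  move: le1 le2; move: (\sum_(C in P | #|C| == 1) 1) (\sum_(C in P | #|C| != 1) 1).
  move: (\sum_(C in P | #|C| == 1) _) (\sum_(C in P | #|C| != 1) _).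
  clear; nia.
have hC C : C \in P -> 3 <= #|C| /\ k + 2 <= #|S| + #|C|.
  by move=> CP; apply: narrow_separator_card.
have half C : C \in P -> k <= 2 * #|C| -> k * (k + 2) <= 4 * cut C.
  move=> CP kC; have [C' CP' CC'] := other C CP.
  by apply: (piece_cut_half k4 CP CP' CC') => //; have [] := hC C' CP'.
have [/forall_inP big|] := boolP [forall C in P, k <= 2 * #|C|].
  apply: (@count_large_pieces k #|S| #|P| tau) => //.
  have : #|P| * (k * (k + 2)) <= \sum_(C in P) 4 * cut C.
    by rewrite -sum_nat_const; apply: leq_sum => C CP; apply: half => //; apply: big.
  rewrite -big_distrr /= => h.
  apply: (@leq_trans (4 * (\sum_(C in P) cut C + inner_degree))).
    by rewrite [X in _ <= X]mulnDr leq_add // leq_mul2l hI orbT.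
  by rewrite leq_mul2l hdeg orbT.
rewrite negb_forall => /existsP[C0]; rewrite negb_imply -ltnNge => /andP[CP0 C0k].
case: (arg_minnP (fun C : {set T} => #|C|) CP0) => C CP minC.
have Ck : 2 * #|C| < k by have := minC C0 CP0; lia.
have [C3 kC] := hC C CP.
apply: (@count_small_piece k #|S| #|P| tau #|C|) => //.
apply: leq_trans hdeg; apply: leq_add => //.
rewrite -sum_nat_const; apply: leq_sum => C' CP'.
have mC := minC C' CP'; have [big|small] := leqP k (2 * #|C'|).
  by have := half C' CP' big; nia.
apply: leq_trans (cut_local C'); nia.
Qed.

End Barrier.

End DistanceRegular.

(** * The theorem *)

Section Extension.
Variables (T : finType) (e : rel T) (k lam : nat).
Hypotheses (hG : distance_regular e) (evT : ~~ odd #|T|).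
Hypotheses (hk : has_valency e k) (hlam : has_lambda e lam) (lam0 : 0 < lam).

Lemma lambda_lt_valency : lam < k.
Proof.
have [[esym eirr] [T0 econn] _] := hG.
have [x _] : exists x : T, x \in T by apply/card_gt0P.
have : 0 < #|predC1 x|.
  by have := cardC1 x; move: evT T0; case: #|T| => [|[|n]] //= _ _ ->.
case/card_gt0P=> y; rewrite inE => yx.
(* a neighbour of y exists because y is connected to another vertex *)
have /connectP[[|z p] /= ep ez] := econn y x; first by rewrite ez eqxx in yx.
have /andP[eyz _] := ep.
rewrite -(hlam eyz) -(hk y); apply/proper_card/properP; split.
  exact: subsetIl.
by exists z; rewrite !inE eyz //= eirr.
Qed.

Lemma matching_extends M : matching e M -> 4 * #|M| <= k + 3 ->
  exists2 N, perfect_matching e N & M \subset N.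
Proof.
have [[esym eirr] [T0 econn] [b [c hbc]]] := hG => mM hM.
have [//|[S [P [bP sMS hP]]]] := extension_or_barrier esym eirr evT mM.
have cM := card_cover_matching eirr mM.
have hS : 2 * #|M| <= #|S| by rewrite -cM subset_leq_card.
have P2 : 1 < #|P| by lia.
have /card_gt1P[C [C' [CP CP' CC']]] := P2.
have /barrierP[_ tP _] := bP.
have nonempty D : D \in P -> exists x, x \in D.
  by move=> DP; apply/set0Pn; rewrite -card_gt0 odd_gt0 // (piece_odd bP DP).
have [x xC] := nonempty C CP; have [y yC'] := nonempty C' CP'.
have yC : y \notin C by rewrite (disjointFl (trivIsetP tP _ _ CP CP' CC')).
have llt : lam + 2 <= k.
  apply: (lambda_lt esym eirr econn hk hlam (x := x) (y := y)).
    by apply: contraNneq yC => <-.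
  apply: contra yC => exy; have /subsetP/(_ y) := piece_nbhd bP CP xC.
  by rewrite !inE exy (negPf (piece_disjoint bP CP' yC')) orbF; apply.
have k4 : 4 <= k.
  rewrite leqNgt; apply/negP=> k3.
  have k3' : k = 3 by lia.
  by have /eqP[] := valency3_lambda esym eirr hk hlam x k3'; lia.
exfalso; apply: (no_barrier esym eirr econn hbc hk hlam bP k4 llt lam0 hM hS _ hP).
exact: (inner_degree_matching esym eirr mM sMS).
Qed.

End Extension.

Theorem corollary3p13 (T : finType) (e : rel T) (k lam : nat)
  (hG : distance_regular e) (heven : ~~ odd #|T|)
  (hk : has_valency e k) (hlam : has_lambda e lam) (hlam1 : 1 <= lam) :
  extendable e (uphalf (k + 2))./2.
Proof.
have lk := lambda_lt_valency hG heven hk hlam.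
have ext := matching_extends hG heven hk hlam hlam1.
have [[esym eirr] gconn _] := hG.
split=> //.
- have m0 : matching e set0.
    by rewrite /matching sub0set; apply/trivIsetP=> A B; rewrite inE.
  by have [|N pN _] := ext _ m0; [rewrite cards0|exists N].
- have [x _] : exists x : T, x \in T by apply/card_gt0P; case: gconn.
  have xN : x \notin nbhd e x by rewrite inE eirr.
  have : #|x |: nbhd e x| <= #|T| := max_card _.
  by rewrite cardsU1 xN hk; lia.
- by move=> M mM cM; apply: ext => //; rewrite cM; lia.
Qed.
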